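(* Let $X$ be a connected finite polyhedron not homeomorphic to the interval or the circle, and let $n\ge1$. Then $F_n(X)$ is path connected.
   Context: $F_n(X)=\{(x_1,\dots,x_n)\in X^n\mid x_i\neq x_j\text{ for } i\ne j\}$, with the subspace topology from $X^n$, is the configuration space of $n$ ordered points of $X$. Path connected means that any two points can be joined by a path. The interval is $[0,1]$. *)

(* Defs.v *)
From HB Require Import structures.
From mathcomp Require Import all_boot all_order all_algebra.
From mathcomp Require Import all_classical all_reals all_analysis.
Import Order.TTheory GRing.Theory Num.Theory.
Import numFieldNormedType.Exports.

Set Implicit Arguments.
Unset Strict Implicit.
Unset Printing Implicit Defensive.

Local Open Scope classical_set_scope.
Local Open Scope ring_scope.

(* A subset [A : set T] used below as a space is [set_type A], the subtype with
   the initial topology of its inclusion in [T], i.e. the subspace topology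
   (not the library's [subspace A], which lives on the whole of [T]). *)

Definition homeomorphic (X Y : topologicalType) : Prop :=
  exists (f : X -> Y) (g : Y -> X),
    [/\ continuous f, continuous g, cancel f g & cancel g f].

Definition path_connected (R : realType) (X : topologicalType) : Prop :=
  forall x y : X, exists gamma : R -> X,
    [/\ {within `[0, 1]%classic, continuous gamma},
        gamma 0 = x & gamma 1 = y].

Definition simplicial_complex (N : nat) (K : {set {set 'I_N}}) : Prop :=
  [/\ finset.set0 \notin K,
      forall v : 'I_N, [set v]%SET \in K &
      forall s t : {set 'I_N},
        s \in K -> t \subset s -> t != finset.set0 -> t \in K].

(* The points of |K| are given by their barycentric coordinates: nonnegative
   weights on the vertices, of sum 1, whose support is a simplex of K. *)
Definition realization (R : realType) (N : nat) (K : {set {set 'I_N}}) :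
    set 'rV[R]_N :=
  [set x | [/\ forall v, 0 <= x 0 v,
               \sum_v x 0 v = 1 &
               finset (fun v => x 0 v != 0) \in K]].
Arguments realization R {N} K.

Definition finite_polyhedron (R : realType) (X : topologicalType) : Prop :=
  exists (N : nat) (K : {set {set 'I_N}}),
    simplicial_complex K /\ homeomorphic X (set_type (realization R K)).

Definition unit_interval (R : realType) : set R := `[0, 1]%classic.
Arguments unit_interval R : clear implicits.

Definition unit_circle (R : realType) : set (R * R) :=
  [set p | p.1 ^+ 2 + p.2 ^+ 2 = 1].
Arguments unit_circle R : clear implicits.

Definition configuration_space (n : nat) (X : topologicalType) :
    set {ptws 'I_n -> X} :=
  [set x | forall i j : 'I_n, i <> j -> x i <> x j].
Arguments configuration_space n X : clear implicits.

(* Main.v *)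
Require Import Defs.
From HB Require Import structures.
From mathcomp Require Import all_boot all_order all_algebra.
From mathcomp Require Import all_classical all_reals all_analysis.
From mathcomp Require Import lra zify.
Import Order.TTheory GRing.Theory Num.Theory.
Import numFieldNormedType.Exports.

Set Implicit Arguments.
Unset Strict Implicit.
Unset Printing Implicit Defensive.

Local Open Scope classical_set_scope.
Local Open Scope ring_scope.

(** A point that moves along a path avoiding the other points of a configuration
    describes a path of configurations ([joined_place]); only such moves are
    used, one point after the other.

    A triod is a union of three arcs with a common end, its centre, and otherwise
    disjoint. Any two configurations in a triod can be joined ([triod_confs]):
    its legs act as stacks, the points in the way of a chosen one can be put
    aside on another leg, so that the chosen one can be brought to the tip of a
    leg, and one goes on with the other points in the rest of the triod. If a
    path connected space contains a triod, every configuration can be moved into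
    it ([gather]): on a path from an outside point to the triod, the outside
    point closest to the entrance can always go in, once the entrance has been
    freed. Hence the configuration space of a path connected Hausdorff space
    that contains a triod is path connected ([tripod_joined_confs]).

    A connected polyhedron is path connected ([polyhedron_joined]). It contains
    a triod as soon as some simplex has three vertices, with centre the middle
    of an edge of a triangle, or some vertex has three neighbours, with centre
    that vertex ([branching_tripod]). Otherwise it is a connected graph of degree
    at most two, and a longest simple path in it shows that its vertices form a
    path or a cycle ([path_or_cycle]); it is then a point, an interval or a circle
    ([unbranched_classification]). The last two cases are excluded, and a space
    with at most one point has at most one configuration of n points when n is
    positive. *)

(** * Paths *)

(** Paths are parametrised by the whole line: their pieces and concatenations are
    then continuous functions without any restriction to the unit interval. *)
Definition joined (R : realType) (Z : topologicalType) (B : set Z) (x y : Z) :=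
  exists f : R -> Z,
    [/\ continuous f, f 0 = x, f 1 = y & forall t, B (f t)].
Arguments joined R {Z} B x y.

Section Paths.
Context {R : realType}.

Lemma continuous_paste (Z : topologicalType) (a : R) (f g : R -> Z) :
  continuous f -> continuous g -> f a = g a ->
  continuous (fun t => if t <= a then f t else g t).
Proof.
move=> cf cg fga; apply/continuous_closedP => A cA.
rewrite (_ : _ @^-1` A = ([set t | t <= a] `&` f @^-1` A) `|`
                         ([set t | a <= t] `&` g @^-1` A)).
  apply: closedU; apply: closedI.
  - exact: closed_le.
  - by move/continuous_closedP: cf; apply.
  - exact: closed_ge.
  - by move/continuous_closedP: cg; apply.
apply/seteqP; split=> t /=.
  by case: (leP t a) => [ta|/ltW ta]; [left|right].
case=> -[ta At]; first by rewrite ta.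
case: (leP t a) => // ta'.
by move: At; rewrite (_ : t = a) ?fga //; apply: le_anti; rewrite ta ta'.
Qed.

Lemma affine_continuous (a b : R) : continuous (fun t : R => a + b * t).
Proof.
by move=> t; apply: cvgD; [exact: cvg_cst|apply: cvgM => //; exact: cvg_cst].
Qed.

Lemma comp_continuous (Y Z W : topologicalType) (f : Z -> W) (g : Y -> Z) :
  continuous f -> continuous g -> continuous (fun t => f (g t)).
Proof. by move=> cf cg t; apply: continuous_comp; [exact: cg|exact: cf]. Qed.

Lemma joined_refl (Z : topologicalType) (B : set Z) x : B x -> joined R B x x.
Proof. by move=> Bx; exists (cst x); split => //; exact: cst_continuous. Qed.

Lemma joined_sym (Z : topologicalType) (B : set Z) x y :
  joined R B x y -> joined R B y x.
Proof.
case=> f [cf f0 f1 fB]; exists (fun t => f (1 + (- 1) * t)).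
split => //.
- exact: comp_continuous cf (@affine_continuous 1 (- 1)).
- by rewrite mulr0 addr0.
- by rewrite mulr1 subrr.
Qed.

Lemma joined_trans (Z : topologicalType) (B : set Z) y x z :
  joined R B x y -> joined R B y z -> joined R B x z.
Proof.
case=> f [cf f0 f1 fB] [g [cg g0 g1 gB]].
exists (fun t => if t <= 2^-1 then f (0 + 2 * t) else g (- 1 + 2 * t)).
split.
- apply: (@continuous_paste _ _ (fun t => f (0 + 2 * t))
                                (fun t => g (- 1 + 2 * t))).
  + exact: comp_continuous cf (@affine_continuous _ _).
  + exact: comp_continuous cg (@affine_continuous _ _).
  + by rewrite mulfV // add0r addNr f1 g0.
- by rewrite invr_ge0 ler0n mulr0 addr0.
- by rewrite ifF; [rewrite -g1; congr g; lra|apply/negbTE; rewrite -ltNge; lra].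
- by move=> t; case: ifP.
Qed.

Lemma joined_in (Z : topologicalType) (B : set Z) x y :
  joined R B x y -> B x /\ B y.
Proof. by case=> f [_ <- <- fB]. Qed.

(** Stopping the clock outside the unit interval turns a path defined on the
    segment of parameters from a to b into one defined on the whole line. *)
Lemma joined_segment (Z : topologicalType) (B : set Z) (f : R -> Z) (a b : R) :
  continuous f ->
  (forall t, Num.min a b <= t <= Num.max a b -> B (f t)) ->
  joined R B (f a) (f b).
Proof.
move=> cf fB.
pose c t : R := Num.max 0 (Num.min 1 t).
have c01 t : 0 <= c t <= 1.
  by rewrite /c le_max lexx /= ge_max ler01 ge_min lexx.
have cc : continuous c.
  move=> t; apply: continuous_max; first exact: cst_continuous.
  by apply: continuous_min; [exact: cst_continuous|].
exists (fun t => f (a + c t * (b - a))); split.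
- apply: comp_continuous cf _ => t.
  apply: cvgD; first exact: cvg_cst.
  by apply: cvgM; [exact: cc|exact: cvg_cst].
- have -> : c 0 = 0 by rewrite /c min_r ?ler01 // maxxx.
  by rewrite mul0r addr0.
- have -> : c 1 = 1 by rewrite /c minxx max_r.
  by congr f; lra.
- move=> t; apply: fB; have := c01 t; move: (c t) => s s01.
  by case: (leP a b) => ab; nra.
Qed.

(** The part of C between a and b is compact, so that it has a maximum. *)
Lemma last_time (C : set R) (a b : R) : closed C -> C a -> a <= b ->
  exists c, [/\ C c, a <= c <= b & forall t, c < t <= b -> ~ C t].
Proof.
move=> cC Ca ab.
have cK : compact (C `&` `[a, b]).
  by rewrite setIC; apply: compact_closedI => //; exact: segment_compact.
have K0 : (C `&` `[a, b]) !=set0.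
  by exists a; split => //=; rewrite in_itv /= lexx.
have [c] := compact_EVT_max K0 cK (continuous_subspaceT (fun x => cvg_id)).
rewrite inE => -[Cc /= ]; rewrite in_itv /= => cab cmax.
exists c; split=> // t /andP[ct tb] Ct.
have : t <= c.
  apply: cmax; rewrite inE; split => //=; rewrite in_itv /= tb andbT.
  by apply: le_trans (ltW ct); case/andP: cab.
by rewrite leNgt ct.
Qed.

Lemma first_time (C : set R) (a b : R) : closed C -> C b -> a <= b ->
  exists c, [/\ C c, a <= c <= b & forall t, a <= t < c -> ~ C t].
Proof.
move=> cC Cb ab.
have cC' : closed ((fun t : R => - t) @^-1` C).
  by apply: (iffLR (continuous_closedP _)) cC; exact: oppr_continuous.
have [||c [Cc cab cC2]] := @last_time _ (- b) (- a) cC'.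
- by rewrite /= opprK.
- by rewrite lerN2.
exists (- c); split => //; first lra.
by move=> t ?; have := cC2 (- t); rewrite /= opprK; apply; lra.
Qed.

End Paths.

(** * Configurations *)

Definition confs (n : nat) (Z : topologicalType) (B : set Z) :
    set {ptws 'I_n -> Z} :=
  [set x | injective x /\ forall i, B (x i)].
Arguments confs n {Z} B.

Definition place (n : nat) (Z : Type) (x : 'I_n -> Z) (j : 'I_n) (q : Z) :
    'I_n -> Z :=
  fun i => if i == j then q else x i.

Lemma ptws_continuous (n : nat) (Y Z : topologicalType)
    (F : Y -> {ptws 'I_n -> Z}) :
  (forall i, continuous (fun y => F y i)) -> continuous F.
Proof.
move=> cF y; apply/cvg_sup => i U [_ [[W oW <-] /= Wy] sub].
apply: filterS (sub) _; apply: cF.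
exact: open_nbhs_nbhs.
Qed.

Lemma ptws_coord_continuous (n : nat) (Z : topologicalType) (i : 'I_n) :
  continuous (fun x : {ptws 'I_n -> Z} => x i).
Proof. by move=> x; exact: (@proj_continuous _ (fun=> Z) i x). Qed.

Lemma set_type_continuous (Y Z : topologicalType) (B : set Z)
    (F : Y -> set_type B) :
  continuous (fun y => set_val (F y)) -> continuous F.
Proof. exact: continuous_comp_initial. Qed.

(** All motions used below move one point at a time, so that a path of
    configurations is obtained from a path in the space that avoids finitely many
    points. *)
Lemma joined_place (R : realType) (n : nat) (Z : topologicalType) (B : set Z)
    (x : {ptws 'I_n -> Z}) (j : 'I_n) (q : Z) :
  confs n B x ->
  joined R (fun z => B z /\ forall i, i != j -> z <> x i) (x j) q ->
  joined R (confs n B) x (place x j q).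
Proof.
move=> [xinj xB] [f [cf f0 f1 fB]].
exists (fun t => place x j (f t)); split.
- apply: ptws_continuous => i; rewrite /place.
  by case: (i == j) => //; exact: cst_continuous.
- by rewrite f0; apply/funext => i; rewrite /place; case: eqP => // ->.
- by rewrite f1.
- move=> t; have [Bft avoid] := fB t; split.
    move=> a b; rewrite /place.
    have [->|aj] := eqVneq a j; have [->|bj] := eqVneq b j => //.
    + by move=> /(avoid _ bj).
    + by move=> /esym /(avoid _ aj).
    + exact: xinj.
  by move=> i; rewrite /place; case: ifP.
Qed.

(** * Configurations on a triod *)

Section Triod.
Context {R : realType} {Z : topologicalType} (gam : 'I_3 -> R -> Z).

(** The legs are parametrised by half-lines, of which [legs] keeps an initial
    segment: shortening a leg is then only a change of length. *)
Definition tripod : Prop :=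
  [/\ forall k, continuous (gam k), forall k l, gam k 0 = gam l 0 &
      forall k l (s t : R), 0 <= s -> 0 <= t -> gam k s = gam l t ->
        (k = l /\ s = t) \/ (s = 0 /\ t = 0)].

Definition legs (len : 'I_3 -> R) : set Z :=
  [set z | exists k (t : R), 0 <= t <= len k /\ z = gam k t].

Hypothesis tri : tripod.

Lemma tripod_inj k l (s t : R) : 0 <= s -> 0 < t -> gam k s = gam l t ->
  k = l /\ s = t.
Proof.
have [_ _ ginj] := tri => s0 t0 /(ginj _ _ _ _ s0 (ltW t0))[//|[_ tE]].
by move: t0; rewrite tE ltxx.
Qed.

Section Stacks.
Context {n : nat} (B : set Z) (len : 'I_3 -> R) (D : {set 'I_n})
  (x0 : {ptws 'I_n -> Z}).
Hypothesis len_gt0 : forall k, 0 < len k.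
Hypothesis legsB : legs len `<=` B.
Hypothesis x0_out : forall i, i \notin D -> ~ legs len (x0 i).

(** A moving point is recorded by its leg and its height on it, which is positive:
    between two moves the centre is free. *)
Definition located (E : {set 'I_n}) (x : 'I_n -> Z) (c : 'I_n -> 'I_3 * R) :=
  forall i, i \in E ->
    0 < (c i).2 <= len (c i).1 /\ x i = gam (c i).1 (c i).2.

Definition fixed (x : 'I_n -> Z) := forall i, i \notin D -> x i = x0 i.

(** The point goes down to the centre and up again. The height s = 0 is allowed
    so that a point standing at the centre can leave it. *)
Lemma leg_change (x : {ptws 'I_n -> Z}) c (j : 'I_n) l (s : R) k (t : R) :
    confs n B x -> fixed x -> j \in D -> located (D :\ j) x c ->
    x j = gam l s -> 0 <= s <= len l -> 0 < t <= len k ->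
    (forall i, i \in D -> i != j -> (c i).1 = l -> s < (c i).2) ->
    (forall i, i \in D -> i != j -> (c i).1 = k -> t < (c i).2) ->
  exists x' : {ptws 'I_n -> Z}, [/\ joined R (confs n B) x x', confs n B x',
    fixed x' & located D x' (place c j (k, t))].
Proof.
move=> xB xfix jD xloc xj sl tk lfree kfree.
have [gc g0 _] := tri.
have leg_free m (u : R) : 0 <= u <= len m ->
    (forall i, i \in D -> i != j -> (c i).1 = m -> u < (c i).2) ->
    joined R (fun z => B z /\ forall i, i != j -> z <> x i) (gam m u) (gam m 0).
  move=> um mfree; apply: joined_segment => // v.
  rewrite min_r ?max_l => [/andP[v0 vu]|//|//]; try by case/andP: um.
  split; first by apply: legsB; exists m, v; split=> //; lra.
  move=> i ij gE; have [iD|iD] := boolP (i \in D); last first.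
    apply: (x0_out iD); rewrite -xfix // -gE; exists m, v; split=> //; lra.
  have [|ci xi] := xloc i; first by rewrite in_setD1 ij.
  have c0 : 0 < (c i).2 by case/andP: ci.
  have [mE vE] := tripod_inj v0 c0 (etrans gE xi).
  have := mfree i iD ij (esym mE); lra.
have J : joined R (confs n B) x (place x j (gam k t)).
  apply: joined_place => //; apply: (@joined_trans _ _ _ (gam l 0)).
    by rewrite xj; apply: leg_free.
  by rewrite (g0 l k); apply/joined_sym/leg_free => //; lra.
exists (place x j (gam k t)); split => //.
- by case: (joined_in J).
- by move=> i iD; rewrite /place; case: eqP => [ij|_]; [rewrite ij jD in iD|exact: xfix].
- move=> i iD; rewrite /place; case: eqVneq => [//|ij].
  by apply: xloc; rewrite in_setD1 ij.
Qed.

Lemma below_all (E : {set 'I_n}) (f : 'I_n -> R) (m : R) :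
  0 < m -> (forall i, i \in E -> 0 < f i) ->
  exists2 e, 0 < e <= m & forall i, i \in E -> e < f i.
Proof.
move=> m0 f0; pose e := \big[Order.min/m]_(i in E) f i.
have e0 : 0 < e by rewrite /e; elim/big_ind: _ => // a b a0 b0; rewrite lt_min a0.
exists (e / 2).
  have : e <= m by exact: bigmin_le_id.
  by move=> ?; lra.
move=> i iE; have : e <= f i by apply: bigmin_le_cond.
by move=> ?; lra.
Qed.

Lemma located_neq (x : {ptws 'I_n -> Z}) c i j : confs n B x -> located D x c ->
  i \in D -> j \in D -> i != j -> (c i).1 = (c j).1 -> (c i).2 != (c j).2.
Proof.
move=> [xinj _] xloc iD jD /eqP ij e1; apply/eqP => e2; apply/ij/xinj.
by have [_ ->] := xloc i iD; have [_ ->] := xloc j jD; rewrite e1 e2.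
Qed.

(** Two legs behave as two stacks open at the centre: the points of one leg that
    lie below a given height can be popped one after the other and pushed onto
    another leg, because there is always room below the points already there. *)
Lemma clear_leg (x : {ptws 'I_n -> Z}) c (l k : 'I_3) (b : R) : l != k ->
    confs n B x -> fixed x -> located D x c ->
  exists (x' : {ptws 'I_n -> Z}) c',
    [/\ joined R (confs n B) x x', confs n B x', fixed x', located D x' c' &
        forall i, i \in D ->
          if ((c i).1 == l) && ((c i).2 < b) then (c' i).1 = k
          else c' i = c i].
Proof.
move=> lk.
have [m] := ubnP #|[set i in D | ((c i).1 == l) && ((c i).2 < b)]|.
elim: m => // m IH in x c *; set S := finset _ => Sm xB xfix xloc.
have [S0|[p0 p0S]] := set_0Vmem S.
  exists x, c; split => //; first exact: joined_refl.
  move=> i iD; have : i \notin S by rewrite S0 inE.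
  by rewrite inE iD /= => /negbTE ->.
have [p pS pmin] := arg_minP (fun i => (c i).2) p0S.
have {}pS : p \in S by [].
have {}pmin i : i \in S -> (c p).2 <= (c i).2 by move=> iS; exact: pmin.
move: (pS); rewrite inE => /and3P[pD /eqP pl pb].
have [t tk tlow] := @below_all D (fun i => (c i).2) (len k) (len_gt0 k)
  (fun i iD => (andP (xloc i iD).1).1).
have [cp xp] := xloc p pD.
have [|||||x1 [J1 x1B x1fix x1loc]] :=
    @leg_change x c p l (c p).2 k t xB xfix pD _ _ _ tk _ _.
- by move=> i /setD1P[_ /xloc].
- by rewrite -pl.
- by rewrite -pl; lra.
- move=> i iD ip il; have [ib|bi] := ltP (c i).2 b; last exact: lt_le_trans bi.
  rewrite lt_neqAle pmin ?inE ?iD ?il ?eqxx ?ib // andbT eq_sym.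
  by apply: (located_neq xB xloc) => //; rewrite il pl.
- by move=> i iD _ _; apply: tlow.
have [|x2 [c2 [J2 x2B x2fix x2loc c2E]]] := IH x1 (place c p (k, t)) _ x1B x1fix x1loc.
  apply: leq_trans (_ : #|S| <= m)%N; last by rewrite -ltnS.
  rewrite [ltnRHS](cardsD1 p) pS add1n ltnS.
  apply/subset_leq_card/fintype.subsetP => i.
  rewrite !inE /place; case: (i == p) => //=.
  by rewrite eq_sym (negbTE lk) /= andbF.
exists x2, c2; split => //; first exact: joined_trans J2.
move=> i iD; have := c2E i iD; rewrite /place.
have [->|//] := eqVneq i p; rewrite /= eq_sym (negbTE lk) /= => ->.
by rewrite pl eqxx pb.
Qed.

Lemma third_leg (k l : 'I_3) : exists m : 'I_3, m != k /\ m != l.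
Proof.
suff /card_gt0P[m] : (0 < #|~: [set k; l]|)%N.
  by rewrite !inE negb_or => /andP[]; exists m.
by rewrite cardsCs finset.setCK card_ord cards2; case: (k != l).
Qed.

(** At most one point stands at the centre, and there is room just above it. *)
Lemma leave_centre (x : {ptws 'I_n -> Z}) :
  confs n B x -> fixed x -> (forall i, i \in D -> legs len (x i)) ->
  exists (x' : {ptws 'I_n -> Z}) c,
    [/\ joined R (confs n B) x x', confs n B x', fixed x' & located D x' c].
Proof.
move=> xB xfix xleg; have [_ g0 _] := tri.
have /choice[c cE] i : exists c : 'I_3 * R, i \in D ->
    0 <= c.2 <= len c.1 /\ x i = gam c.1 c.2.
  have [iD|_] := boolP (i \in D); last by exists (ord0, 0).
  by have [k [t [kt xi]]] := xleg i iD; exists (k, t).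
have [/existsP[j /andP[jD /eqP cj]]|allpos] :=
  boolP [exists j, (j \in D) && ((c j).2 == 0)]; last first.
  exists x, c; split => //; first exact: joined_refl.
  move=> i iD; have [ci xi] := cE i iD; split => //.
  have : (c i).2 != 0.
    by apply: contra allpos => ci0; apply/existsP; exists i; rewrite iD.
  by case/andP: ci => ? -> ?; rewrite andbT lt_neqAle eq_sym; apply/andP.
have xloc : located (D :\ j) x c.
  move=> i /setD1P[ij iD]; have [ci xi] := cE i iD; split => //.
  case/andP: ci => ci0 ->; rewrite andbT lt_neqAle ci0 andbT eq_sym.
  apply: contra ij => /eqP ci; apply/eqP; case: xB => + _; apply.
  by rewrite xi ci (cE j jD).2 cj.
have [t tk tlow] := @below_all (D :\ j) (fun i => (c i).2) (len ord0)
  (len_gt0 ord0) (fun i iD => (andP (xloc i iD).1).1).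
have [cj1 xj] := cE j jD.
have [||x1 [J1 x1B x1fix x1loc]] :=
    @leg_change x c j (c j).1 (c j).2 ord0 t xB xfix jD xloc xj cj1 tk _ _.
- move=> i iD ij _; rewrite cj; have /xloc[] : i \in D :\ j by apply/setD1P.
  by case/andP.
- by move=> i iD ij _; apply: tlow; apply/setD1P.
by exists x1, (place c j (ord0, t)).
Qed.

(** A chosen point is brought to the tip of a given leg: the points in front of
    it are popped away, it is parked just off the centre on another leg if it
    stands on the given one, and the given leg is then emptied onto the
    third. *)
Lemma to_tip (x : {ptws 'I_n -> Z}) c (j : 'I_n) (o : 'I_3) : j \in D ->
    confs n B x -> fixed x -> located D x c ->
  exists (x' : {ptws 'I_n -> Z}) c',
    [/\ joined R (confs n B) x x', confs n B x', fixed x', located D x' c' &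
        c' j = (o, len o) /\ forall i, i \in D -> i != j -> (c' i).1 != o].
Proof.
move=> jD xB xfix xloc.
(* The points below j on its leg are moved to a leg k other than that of j and o. *)
have [k [kl ko]] := third_leg (c j).1 o.
have [|x1 [c1 [J1 x1B x1fix x1loc c1E]]] :=
  @clear_leg x c (c j).1 k (c j).2 _ xB xfix xloc; first by rewrite eq_sym.
have c1j : c1 j = c j by have := c1E j jD; rewrite ltxx andbF.
have j_first i : i \in D -> i != j -> (c1 i).1 = (c1 j).1 -> (c1 j).2 < (c1 i).2.
  move=> iD ij e; rewrite lt_neqAle eq_sym (located_neq x1B x1loc iD jD ij e) /=.
  have := c1E i iD; case: ifP => [_ ck|+ c1i].
    by move: kl; rewrite -ck e c1j eqxx.
  by rewrite -c1i -c1j e eqxx /= => /negbT; rewrite -leNgt.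
(* If j is on leg o, it is moved to leg k, where it becomes the lowest point. *)
have [x2 [c2 [k2 [J2 x2B x2fix x2loc [k2o k2j c2jo j2_first]]]]] :
  exists (x2 : {ptws 'I_n -> Z}) c2 (k2 : 'I_3), [/\ joined R (confs n B) x x2,
    confs n B x2, fixed x2, located D x2 c2 &
    [/\ k2 != o, k2 != (c2 j).1, (c2 j).1 != o & forall i, i \in D -> i != j ->
       (c2 i).1 = (c2 j).1 -> (c2 j).2 < (c2 i).2]].
  have [cjo|cjo] := eqVneq (c j).1 o; last first.
    exists x1, c1, k; rewrite c1j; split=> //; split=> // i iD ij.
    by have := j_first i iD ij; rewrite c1j.
  have [t tk tlow] := @below_all D (fun i => (c1 i).2) (len k) (len_gt0 k)
    (fun i iD => (andP (x1loc i iD).1).1).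
  have [c1jp x1j] := x1loc j jD.
  have [|||x2 [J2 x2B x2fix x2loc]] :=
      @leg_change x1 c1 j (c1 j).1 (c1 j).2 k t x1B x1fix jD _ x1j _ tk j_first _.
  - by move=> i /setD1P[_ /x1loc].
  - by lra.
  - by move=> i iD _ _; apply: tlow.
  have [k2 [k2k k2o]] := third_leg k o.
  exists x2, (place c1 j (k, t)), k2; split => //; first exact: joined_trans J2.
  have -> : place c1 j (k, t) j = (k, t) by rewrite /place eqxx.
  split => // i iD ij.
  by rewrite /place (negbTE ij) => _; apply: tlow.
(* The height len o + 1 exceeds all heights on leg o, which is emptied. *)
have [|x3 [c3 [J3 x3B x3fix x3loc c3E]]] :=
  @clear_leg x2 c2 o k2 (len o + 1) _ x2B x2fix x2loc; first by rewrite eq_sym.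
have c3j : c3 j = c2 j by have := c3E j jD; rewrite (negbTE c2jo).
have o_free i : i \in D -> (c3 i).1 != o.
  move=> iD; have := c3E i iD; case: ifP => [_ -> //|+ ->].
  move=> /negbT; apply: contra => /eqP e; rewrite e eqxx /=.
  by have [] := x2loc i iD; rewrite e => ? _; lra.
have [c3jp x3j] := x3loc j jD.
have [|||||x4 [J4 x4B x4fix x4loc]] :=
  @leg_change x3 c3 j (c3 j).1 (c3 j).2 o (len o) x3B x3fix jD _ x3j _ _ _ _.
- by move=> i /setD1P[_ /x3loc].
- by lra.
- by rewrite len_gt0 lexx.
- move=> i iD ij; rewrite c3j; have := c3E i iD.
  case: ifP => [_ -> e|_ ->]; last exact: j2_first.
  by move: k2j; rewrite e eqxx.
- by move=> i iD ij /eqP; rewrite (negbTE (o_free i iD)).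
exists x4, (place c3 j (o, len o)); split => //.
  by apply: joined_trans J4; exact: joined_trans J3.
rewrite {1}/place eqxx; split=> // i iD ij.
by rewrite /place (negbTE ij); exact: o_free.
Qed.

End Stacks.

(** The points of D travel inside the triod while the others, which lie outside
    it, stand still. By induction on the number of travellers: in both
    configurations the same point is brought to the tip of the same leg and all
    others are sent to the two other legs; half of that leg is then cut off, so
    that the stored point counts among the outside points of a smaller triod. *)
Lemma triod_confs (n : nat) (B : set Z) (D : {set 'I_n}) (len : 'I_3 -> R)
    (x y : {ptws 'I_n -> Z}) :
    (forall k, 0 < len k) -> legs len `<=` B -> confs n B x -> confs n B y ->
    (forall i, i \in D -> legs len (x i) /\ legs len (y i)) ->
    (forall i, i \notin D -> x i = y i /\ ~ legs len (x i)) ->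
  joined R (confs n B) x y.
Proof.
have [m] := ubnP #|D|; elim: m => // m IH in D len x y * => Dm len0 legsB xB yB inD outD.
have [D0|[j jD]] := set_0Vmem D.
  rewrite (_ : x = y); first exact: joined_refl.
  by apply/funext => i; have [] := outD i; rewrite ?D0 ?inE.
have out i : i \notin D -> ~ legs len (x i) by move=> /outD[].
have tip z : confs n B z -> (forall i, i \in D -> legs len (z i)) ->
    (forall i, i \notin D -> z i = x i) -> exists (z' : {ptws 'I_n -> Z}) c,
    [/\ joined R (confs n B) z z', confs n B z', (forall i, i \notin D -> z' i = x i),
      located len D z' c & c j = (ord0, len ord0) /\
        forall i, i \in D -> i != j -> (c i).1 != ord0].
  move=> zB zin zout.
  have [z1 [c1 [J1 z1B z1fix z1loc]]] := leave_centre len0 legsB out zB zout zin.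
  have [z2 [c2 [J2 z2B z2fix z2loc z2tip]]] :=
    to_tip len0 legsB out ord0 jD z1B z1fix z1loc.
  by exists z2, c2; split=> //; exact: joined_trans J2.
have [x1 [cx [Jx x1B x1fix x1loc [cxj cxo]]]] :=
  tip x xB (fun i iD => (inD i iD).1) (fun i _ => erefl).
have [y1 [cy [Jy y1B y1fix y1loc [cyj cyo]]]] :=
  tip y yB (fun i iD => (inD i iD).2) (fun i iD => esym (outD i iD).1).
apply: (joined_trans Jx); apply: joined_trans (joined_sym Jy).
pose len' k := if k == ord0 then len ord0 / 2 else len k.
have legs' : legs len' `<=` legs len.
  move=> z [k [t [tk ->]]]; exists k, t; split => //.
  by move: tk; rewrite /len'; case: eqP => [->|//] ?; have := len0 ord0; lra.
have stay z c i : located len D z c -> i \in D -> (c i).1 != ord0 -> legs len' (z i).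
  move=> zloc iD ci; have [ciE ->] := zloc i iD.
  by exists (c i).1, (c i).2; rewrite /len' (negbTE ci); split=> //; lra.
have x1j : x1 j = gam ord0 (len ord0) by have [_ ->] := x1loc j jD; rewrite cxj.
have y1j : y1 j = gam ord0 (len ord0) by have [_ ->] := y1loc j jD; rewrite cyj.
apply: (IH (D :\ j) len') => //.
- by move: Dm; rewrite (cardsD1 j) jD ltnS.
- move=> k; rewrite /len'; have := len0 ord0; have := len0 k.
  by case: ifP => _; lra.
- exact: subset_trans legs' legsB.
- move=> i /setD1P[ij iD].
  by split; [exact: stay (cxo i iD ij)|exact: stay (cyo i iD ij)].
- move=> i; rewrite in_setD1 negb_and negbK => /orP[/eqP->|iD]; last first.
    rewrite x1fix // y1fix //; split => // /legs'; exact: out.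
  rewrite x1j y1j; split => // -[k [t [tk e]]].
  have l0 := len0 ord0.
  have t0 : 0 <= t by case/andP: tk.
  have [ke te] := tripod_inj t0 l0 (esym e).
  by move: tk; rewrite ke /len' eqxx te; lra.
Qed.

End Triod.

(** * From the whole space to a triod *)

Section Gather.
Context {R : realType} {Z : topologicalType} (A B : set Z).

(** The points outside A are brought into A one by one: follow a path from such
    a point until it first enters A, and let the last outside point met on this
    path travel along its remaining piece, which no other outside point meets;
    the points in A have only to leave the entrance free. *)
Lemma gather (n : nat) (x : {ptws 'I_n -> Z}) :
    hausdorff_space Z -> closed A -> A !=set0 -> A `<=` B ->
    (forall u v, B u -> B v -> joined R B u v) ->
    (forall (y : {ptws 'I_n -> Z}) a, confs n B y -> A a ->
       exists y' : {ptws 'I_n -> Z},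
       [/\ joined R (confs n B) y y', forall i, ~ A (y i) -> y' i = y i,
           forall i, A (y i) -> A (y' i) & forall i, y' i <> a]) ->
    confs n B x ->
  exists x' : {ptws 'I_n -> Z}, joined R (confs n B) x x' /\ forall i, A (x' i).
Proof.
move=> Zhaus cA [a0 Aa0] AB Bpath clear.
pose out (y : {ptws 'I_n -> Z}) := [set i | ~~ `[< A (y i) >]]%SET.
have outP y i : i \in out y <-> ~ A (y i).
  by rewrite inE; split => [/asboolPn|] // ?; apply/asboolPn.
have [m] := ubnP #|out x|; elim: m => // m IH in x *; rewrite ltnS => xm xB.
have [out0|[i /outP iA]] := set_0Vmem (out x).
  exists x; split; first exact: joined_refl.
  move=> i; apply: contrapT => /(outP x); by rewrite out0 inE.
have [f [cf f0 f1 fB]] := Bpath (x i) a0 (xB.2 i) (AB _ Aa0).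
(* t1 is the time at which the path enters A, and t0 the last time before t1 at
   which it meets a point of the configuration that lies outside A. *)
have cfA : closed (f @^-1` A) by apply: (iffLR (continuous_closedP _)).
have [|t1 [At1 t01 before]] := @first_time _ _ 0 1 cfA _ ler01.
  by rewrite /= f1.
have [x1 [J1 x1out x1in x1a]] := clear x (f t1) xB At1.
have x1B := (joined_in J1).2.
pose P := f @^-1` (x1 @` [set k | ~ A (x1 k)]).
have cP : closed P.
  apply: (iffLR (continuous_closedP _)) => //.
  have /accessible_finite_set_closed := hausdorff_accessible Zhaus; apply.
  by apply: finite_image; exact: finite_finset.
have [||t0 [[k kA fk] t0in after]] := @last_time _ P 0 t1 cP _ _.
- by exists i; rewrite /= x1out.
- by case/andP: t01.
pose x2 : {ptws 'I_n -> Z} := place x1 k (f t1).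
have J2 : joined R (confs n B) x1 x2.
  apply: joined_place => //; rewrite fk; apply: joined_segment => // t.
  rewrite min_l ?max_r => [/andP[t0t tt1]||]; try by case/andP: t0in.
  split=> // p pk fp; have [pA|pA] := pselect (A (x1 p)).
    have [tlt|tge] := ltP t t1.
      by apply: (before t); [lra|rewrite /= fp].
    apply: (x1a p); rewrite -fp; congr f; lra.
  have [t0lt|tle] := ltP t0 t.
    by apply: (after t); [rewrite t0lt|exists p].
  move: pk => /eqP; apply; apply: x1B.1; rewrite fk -fp; congr f; lra.
have out2 : (#|out x2| < #|out x|)%N.
  rewrite [ltnRHS](cardsD1 k); have -> : k \in out x.
    by apply/outP => kA'; apply: kA; exact: x1in.
  rewrite add1n ltnS; apply/subset_leq_card/fintype.subsetP => p /outP.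
  rewrite /x2 /place in_setD1; case: eqP => [_ //|_ pA] /=.
  by apply/outP => pA'; apply: pA; exact: x1in.
have [|x3 [J3 x3A]] := IH x2 _ (joined_in J2).2.
  exact: leq_trans out2 xm.
by exists x3; split => //; apply: joined_trans J3; exact: joined_trans J2.
Qed.

End Gather.

Lemma legs_closed (R : realType) (Z : topologicalType)
    (gam : 'I_3 -> R -> Z) (len : 'I_3 -> R) :
  hausdorff_space Z -> tripod gam -> closed (legs gam len).
Proof.
move=> Zhaus [gc _ _].
rewrite (_ : legs gam len = \bigcup_k (gam k @` `[0, len k]%classic)).
  apply: closed_bigcup; first exact: finite_finset.
  move=> k _; apply: compact_closed => //; apply: continuous_compact.
    exact: continuous_subspaceT.
  exact: segment_compact.
apply/seteqP; split=> z.
  by move=> [k [t [tk ->]]]; exists k => //; exists t => //=; rewrite in_itv.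
by move=> [k _ [t]]; rewrite /= in_itv /= => tk <-; exists k, t.
Qed.

(** Some leg does not contain the given point, except perhaps as its centre, and
    it has room for all the points of the triod. *)
Lemma legs_clear (R : realType) (Z : topologicalType) (n : nat) (B : set Z)
    (gam : 'I_3 -> R -> Z) (x : {ptws 'I_n -> Z}) (a : Z) :
    tripod gam -> let A := legs gam (fun=> 1) in A `<=` B -> confs n B x -> A a ->
  exists x' : {ptws 'I_n -> Z},
    [/\ joined R (confs n B) x x', forall i, ~ A (x i) -> x' i = x i,
        forall i, A (x i) -> A (x' i) & forall i, x' i <> a].
Proof.
move=> tri A AB xB Aa.
have [l [t [tl aE]]] := Aa; have [k [kl _]] := third_leg l l.
pose h (i : 'I_n) : R := i.+1%:R / n.+1%:R.
have h01 i : 0 < h i <= 1.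
  rewrite /h divr_gt0 ?ltr0n //= ler_pdivrMr ?ltr0n // mul1r ler_nat.
  by rewrite ltnW // ltnS.
have Ah i : A (gam k (h i)).
  by exists k, (h i); split=> //; case/andP: (h01 i) => /ltW -> ->.
have hinj i j : gam k (h i) = gam k (h j) -> i = j.
  have [/andP[hi _] /andP[hj _]] := (h01 i, h01 j).
  case/(tripod_inj tri (ltW hi) hj) => _ /(mulIf (invr_neq0 (lt0r_neq0 (ltr0Sn R n)))) /eqP.
  by rewrite eqr_nat eqSS => /eqP/val_inj.
pose y : {ptws 'I_n -> Z} := fun i => if `[< A (x i) >] then gam k (h i) else x i.
have yB : confs n B y.
  split=> [i j|i]; rewrite /y; last by case: asboolP => // _; [exact: AB|exact: xB.2].
  case: asboolP => iA; case: asboolP => jA; first exact: hinj.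
  - by move=> e; case: jA; rewrite -e.
  - by move=> e; case: iA; rewrite e.
  - exact: xB.1.
exists y; split.
- apply: (@triod_confs _ _ gam tri n B [set i | `[< A (x i) >]]%SET (fun=> 1)) => //.
  + by move=> i; rewrite inE => /[dup] /asboolP Axi; rewrite /y => ->; split => //; exact: Ah.
  + by move=> i; rewrite inE => /[dup] /asboolPn Axi; rewrite /y => /negbTE ->; split.
- by move=> i iA; rewrite /y asboolF.
- by move=> i iA; rewrite /y asboolT.
- move=> i; rewrite /y; case: asboolP => [_|iA e]; last by apply: iA; rewrite e.
  have [t0 hi] : 0 <= t /\ 0 < h i by case/andP: tl; case/andP: (h01 i).
  rewrite aE => /esym/(tripod_inj tri t0 hi)[/esym/eqP].
  by rewrite (negbTE kl).
Qed.

Lemma tripod_joined_confs (R : realType) (Z : topologicalType) (n : nat)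
    (B : set Z) (gam : 'I_3 -> R -> Z) (x y : {ptws 'I_n -> Z}) :
    hausdorff_space Z -> tripod gam -> legs gam (fun=> 1) `<=` B ->
    (forall u v, B u -> B v -> joined R B u v) ->
    confs n B x -> confs n B y ->
  joined R (confs n B) x y.
Proof.
move=> Zhaus tri AB Bpath.
pose A := legs gam (fun=> 1).
have A0 : A !=set0 by exists (gam ord0 0), ord0, 0; rewrite lexx ler01.
have cA : closed A by exact: legs_closed.
have gath z : confs n B z -> exists z' : {ptws 'I_n -> Z},
    joined R (confs n B) z z' /\ forall i, A (z' i).
  apply: (gather Zhaus cA A0 AB Bpath) => u a uB Aa; exact: legs_clear.
move=> /gath[x' [Jx xA]] /gath[y' [Jy yA]].
apply: (joined_trans Jx); apply: joined_trans (joined_sym Jy).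
apply: (@triod_confs _ _ gam tri n B [set: 'I_n]%SET (fun=> 1)) => //.
- exact: (joined_in Jx).2.
- exact: (joined_in Jy).2.
- by move=> i _; split; [exact: xA|exact: yA].
- by move=> i; rewrite inE.
Qed.

(** * Polyhedra *)

Section Polyhedron.
Context {R : realType} {N : nat} (K : {set {set 'I_N}}).
Hypothesis Kcplx : simplicial_complex K.
Local Notation B := (realization R K).

Definition vert (v : 'I_N) : 'rV[R]_N := delta_mx 0 v.

Lemma vertE v w : vert v 0 w = (w == v)%:R.
Proof. by rewrite mxE eqxx. Qed.

Definition face (s : {set 'I_N}) : set 'rV[R]_N :=
  [set x | [/\ forall v, 0 <= x 0 v, \sum_v x 0 v = 1 &
               forall v, v \notin s -> x 0 v = 0]].

Lemma face_realization s x : s \in K -> face s x -> B x.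
Proof.
have [_ _ Ksub] := Kcplx => sK [x0 x1 xs]; split => //.
apply: (Ksub s) => //.
  apply/fintype.subsetP => v; rewrite inE; apply: contraR => /xs ->.
  by rewrite eqxx.
apply: contraPneq x1 => e; rewrite big1 => [/esym/eqP|v _]; first by rewrite oner_eq0.
have : v \notin [set v | x 0 v != 0]%SET by rewrite e inE.
by rewrite inE negbK => /eqP.
Qed.

Lemma realization_face x : B x ->
  exists2 s, s \in K & face s x /\ forall v, (v \in s) = (x 0 v != 0).
Proof.
move=> [x0 x1 xK]; exists [set v | x 0 v != 0]%SET => //.
split=> [|v]; last by rewrite inE.
by split=> // v; rewrite inE negbK => /eqP.
Qed.

Lemma vert_face (s : {set 'I_N}) v : v \in s -> face s (vert v).
Proof.
move=> vs; split.
- by move=> w; rewrite vertE ler0n.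
- rewrite (bigD1 v) //= vertE eqxx big1 ?addr0 // => w /negbTE wv.
  by rewrite vertE wv.
- by move=> w; rewrite vertE; case: eqP => // -> /negP.
Qed.

Lemma vert_realization v : B (vert v).
Proof.
have [_ Kv _] := Kcplx; apply: (face_realization (Kv v)).
by apply: vert_face; rewrite inE.
Qed.

Lemma face_segment s x y (t : R) : face s x -> face s y -> 0 <= t <= 1 ->
  face s (x + t *: (y - x)).
Proof.
move=> [x0 x1 xs] [y0 y1 ys] t01; split.
- by move=> v; rewrite !mxE; have := x0 v; have := y0 v; nra.
- under eq_bigr do rewrite !mxE.
  by rewrite big_split /= -mulr_sumr sumrB x1 y1 subrr mulr0 addr0.
- by move=> v vs; rewrite !mxE xs // ys // subrr mulr0 addr0.
Qed.

Lemma segment_continuous (x d : 'rV[R]_N) : continuous (fun t : R => x + t *: d).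
Proof.
move=> t; apply: cvgD; first exact: cvg_cst.
by apply: cvgZ; [exact: cvg_id|exact: cvg_cst].
Qed.

Lemma face_joined s x y : s \in K -> face s x -> face s y -> joined R B x y.
Proof.
move=> sK xs ys.
have := @joined_segment R _ B (fun t => x + t *: (y - x)) 0 1.
rewrite scale0r addr0 scale1r [x + (y - x)]addrC subrK; apply; first exact: segment_continuous.
move=> t; rewrite min_l // max_r // => t01.
by apply: face_realization sK _; apply: face_segment.
Qed.

Definition adj (v w : 'I_N) := (v != w) && ([set v; w]%SET \in K).

Lemma adj_sym v w : adj v w = adj w v.
Proof. by rewrite /adj eq_sym finset.setUC. Qed.

Lemma simplex_adj (s : {set 'I_N}) v w : s \in K -> v \in s -> w \in s -> v != w -> adj v w.
Proof.
have [_ _ Ksub] := Kcplx => sK vs ws vw; rewrite /adj vw /=; apply: (Ksub s) => //.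
  by apply/fintype.subsetP => u; rewrite !inE => /orP[]/eqP->.
by apply/set0Pn; exists v; rewrite !inE eqxx.
Qed.

(** The weight carried by a set of vertices closed under adjacency takes only
    the values 0 and 1, hence is constant on a connected polyhedron. *)
Lemma connected_adj (S : {set 'I_N}) v0 : connected [set: set_type B] ->
  v0 \in S -> (forall v w, v \in S -> adj v w -> w \in S) -> forall w, w \in S.
Proof.
move=> Bconn v0S Sadj w.
pose g (x : 'rV[R]_N) := \sum_(v in S) x 0 v.
have cg : continuous (fun x : set_type B => g (set_val x)).
  apply: comp_continuous; last exact: initial_continuous.
  apply: continuous_big => [|v _]; first exact: add_continuous.
  exact: coord_continuous.
have g01 x : B x -> g x = 0 \/ g x = 1.
  move=> /realization_face[s sK [[x0 x1 xs] sE]].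
  have [/exists_inP[v vs vS]|/exists_inPn sS] := boolP [exists v in s, v \in S]; last first.
    left; rewrite /g big1 // => v vS; apply: xs.
    by apply/negP => /sS; rewrite vS.
  right; rewrite /g -[RHS]x1 [RHS](bigID (mem S)) /= [X in _ = _ + X]big1 ?addr0 //.
  move=> u uS; apply: xs; apply: contra uS => us.
  have [<- //|vu] := eqVneq v u.
  exact: Sadj vS (simplex_adj sK vs us vu).
have gvert v : g (vert v) = (v \in S)%:R.
  rewrite /g; under eq_bigr do rewrite vertE.
  have [vS|vS] := boolP (v \in S).
    by rewrite (bigD1 v) //= eqxx big1 ?addr0 // => u /andP[_ /negbTE ->].
  by rewrite big1 // => u uS; case: eqP => // uv; rewrite -uv uS in vS.
pose pt v : set_type B := SigSub (mem_set (vert_realization v)).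
have : [set x : set_type B | 2^-1 < g (set_val x)] = setT.
  apply: Bconn.
  - by exists (pt v0); rewrite /= gvert v0S /=; lra.
  - exists [set x : set_type B | 2^-1 < g (set_val x)]; last by rewrite setTI.
    exact: (iffLR (continuousP _) cg [set r | 2^-1 < r] (@open_gt _ _)).
  - exists [set x : set_type B | 2^-1 <= g (set_val x)].
      exact: (iffLR (continuous_closedP _) cg [set r | 2^-1 <= r] (@closed_ge _ _)).
    rewrite setTI; apply/seteqP; split => x /=; first exact: ltW.
    have /g01[->|->] : B (set_val x) by exact: set_valP.
      lra.
    lra.
move=> /seteqP[_ /(_ (pt w) Logic.I)] /=; rewrite gvert.
by case: (w \in S) => //=; lra.
Qed.

Lemma polyhedron_joined x y : connected [set: set_type B] -> B x -> B y ->
  joined R B x y.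
Proof.
move=> Bconn.
have to_vert z : B z -> exists v, joined R B z (vert v).
  move=> /realization_face[s sK [zs sE]].
  have [s0|[v vs]] := set_0Vmem s; first by case: Kcplx; rewrite -s0 sK.
  by exists v; apply: (face_joined sK) => //; exact: vert_face.
move=> /to_vert[v xv] /to_vert[w yw].
apply: (joined_trans xv); apply: joined_trans (joined_sym yw).
suff : w \in [set w | `[< joined R B (vert v) (vert w) >]]%SET by rewrite inE => /asboolP.
apply: (connected_adj (v0 := v)) => //.
  by rewrite inE; apply/asboolP/joined_refl/vert_realization.
move=> u u'; rewrite [u \in _]inE [u' \in _]inE.
move=> /asboolP vu /andP[_ uK]; apply/asboolP.
apply: (joined_trans vu); apply: (face_joined uK);
  by apply: vert_face; rewrite !inE eqxx ?orbT.
Qed.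

(** A point z of the polyhedron that is joined by segments to three vertices. It
    is the centre of a triod, and covers both ways in which a polyhedron can fail
    to be a graph of degree at most two. *)
Definition branching := exists (z : 'rV[R]_N) (w : 'I_3 -> 'I_N), injective w /\
  forall k, z 0 (w k) < 1 /\ exists s, [/\ s \in K, face s z & w k \in s].

(** The legs meet only at z: the weight of a given vertex w k strictly increases
    along the leg towards w k and does not increase along the two others. *)
Lemma branching_tripod : branching ->
  exists gam : 'I_3 -> R -> 'rV[R]_N, tripod gam /\ legs gam (fun=> 1) `<=` B.
Proof.
move=> [z [w [winj zw]]].
exists (fun k t => z + t *: (vert (w k) - z)); split.
  split=> [k|k l|k l s t s0 t0].
  - exact: segment_continuous.
  - by rewrite !scale0r.
  have [zk1 [sk [_ [z0 _ _] _]]] := zw k; have [zl1 _] := zw l.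
  move=> e; have := congr1 (fun x : 'rV_N => x 0 (w k)) e.
  have := congr1 (fun x : 'rV_N => x 0 (w l)) e.
  rewrite !mxE !eqxx /= !(inj_eq winj) eq_sym.
  have := z0 (w k); have := z0 (w l).
  have [<-|kl] := eqVneq k l => /= zl0 zk0 el ek.
    left; split => //; have : (s - t) * (1 - z 0 (w k)) = 0 by lra.
    move/eqP; rewrite mulf_eq0 subr_eq0 => /orP[/eqP //|]; lra.
  right; split; nra.
move=> x [k [t [t01 ->]]]; have [_ [s [sK zs ws]]] := zw k.
by apply: (face_realization sK); apply: face_segment => //; exact: vert_face.
Qed.

Lemma triple_tnth (a b c : 'I_N) : a != b -> a != c -> b != c ->
  injective (tnth [tuple a; b; c]).
Proof. by move=> ab ac bc; apply/tuple_uniqP; rewrite /= !inE negb_or ab ac bc. Qed.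

Lemma triangle_branching (s : {set 'I_N}) a b c : s \in K -> a \in s -> b \in s -> c \in s ->
  a != b -> a != c -> b != c -> branching.
Proof.
move=> sK sa sb sc ab ac bc.
(* The middle of an edge of the triangle is joined to all three vertices. *)
exists (vert a + 2^-1 *: (vert b - vert a)), (tnth [tuple a; b; c]).
split; first exact: triple_tnth.
move=> k; split.
  have : tnth [tuple a; b; c] k \in [tuple a; b; c] by exact: mem_tnth.
  rewrite !mxE eqxx /= !inE => /or3P[]/eqP ->; rewrite ?eqxx.
  - by rewrite (negbTE ab) /=; lra.
  - by rewrite [b == a]eq_sym (negbTE ab) /=; lra.
  - by rewrite [c == a]eq_sym (negbTE ac) [c == b]eq_sym (negbTE bc) /=; lra.
exists s; split => //.
  by apply: face_segment; [exact: vert_face|exact: vert_face|lra].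
have : tnth [tuple a; b; c] k \in [tuple a; b; c] by exact: mem_tnth.
by rewrite !inE => /or3P[]/eqP ->.
Qed.

Lemma degree_branching v a b c : adj v a -> adj v b -> adj v c ->
  a != b -> a != c -> b != c -> branching.
Proof.
move=> va vb vc ab ac bc.
exists (vert v), (tnth [tuple a; b; c]); split; first exact: triple_tnth.
move=> k.
have : tnth [tuple a; b; c] k \in [tuple a; b; c] by exact: mem_tnth.
suff nbr u : adj v u -> vert v 0 u < 1 /\ exists s, [/\ s \in K, face s (vert v) & u \in s].
  by rewrite !inE => /or3P[]/eqP ->; apply: nbr.
move=> /andP[vu uK]; rewrite vertE eq_sym (negbTE vu); split; first exact: ltr01.
exists [set v; u]%SET; split => //; last by rewrite !inE eqxx orbT.
by apply: vert_face; rewrite !inE eqxx.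
Qed.

End Polyhedron.

(** * Graphs of degree at most two *)

(** A longest simple path absorbs all neighbours of its vertices: those of its
    ends by maximality, the others because their two neighbours on the path are
    their only ones.  The only edge it can miss is the one between its ends. *)
Lemma path_or_cycle (T : finType) (e : rel T) (v0 : T) :
    symmetric e -> irreflexive e ->
    (forall v a b c, e v a -> e v b -> e v c ->
       a != b -> a != c -> b != c -> False) ->
    (forall (S : {set T}) v, v \in S ->
       (forall u u', u \in S -> e u u' -> u' \in S) -> forall u, u \in S) ->
  exists (m : nat) (w : nat -> T),
    [/\ forall i, (i < m)%N -> e (w i) (w i.+1),
        forall v, exists2 i, (i <= m)%N & w i = v,
        forall v v', e v v' -> exists2 i, (i < m)%N &
          (v = w i /\ v' = w i.+1) \/ (v' = w i /\ v = w i.+1) &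
        (forall i j, (i <= m)%N -> (j <= m)%N -> w i = w j -> i = j) \/
        [/\ (2 < m)%N, w m = w 0%N & forall i j, (i < m)%N -> (j < m)%N ->
             w i = w j -> i = j]].
Proof.
move=> esym eirr deg2 econn.
pose P k := [exists t : k.-tuple T, uniq t && sorted e t].
have P1 : exists k, P k by exists 1%N; apply/existsP; exists [tuple v0].
have Pbound k : P k -> (k <= #|T|)%N.
  by case/existsP => t /andP[ut _]; rewrite -(size_tuple t) -(card_uniqP ut) max_card.
have [k /existsP[t /andP[ut st]] kmax] := ex_maxnP P1 Pbound.
have longest q : uniq q -> sorted e q -> (size q <= k)%N.
  move=> uq sq; apply: kmax; apply/existsP; exists (in_tuple q).
  by rewrite uq sq.
move: (size_tuple t) ut st; case: (tval t) => [|x s] sz ut st.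
  by have := longest [:: v0] isT isT; rewrite -sz.
pose w := nth x (x :: s); pose l := size s.
have {sz kmax} sz : k = l.+1 by [].
have wedge i : (i < l)%N -> e (w i) (w i.+1).
  by move=> il; have /sortedP := st; apply.
have winj i j : (i <= l)%N -> (j <= l)%N -> w i = w j -> i = j.
  by move=> il jl /eqP; rewrite nth_uniq // => /eqP.
have wmem u : u \in x :: s -> exists2 i, (i <= l)%N & w i = u.
  by move=> /(nthP x)[i il <-]; exists i.
have interior i u : (i.+1 < l)%N -> e (w i.+1) u -> u = w i \/ u = w i.+2.
  move=> il eu; apply: contrapT => /not_orP[/eqP ui /eqP uj].
  apply: (deg2 (w i.+1) (w i) (w i.+2) u) => //; rewrite 1?eq_sym //.
  - by rewrite esym wedge // ltnW.
  - exact: wedge.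
  - by apply/eqP => /winj; lia.
have closed i u : (i <= l)%N -> e (w i) u -> u \in x :: s.
  move=> il eu; apply: contraT => us.
  have [i0|i0] := posnP i.
    rewrite i0 in eu; have /= := longest (u :: x :: s); rewrite sz ltnn.
    by apply; [rewrite us|rewrite esym eu].
  have [iE|iE] := eqVneq i l.
    suff : (size (rcons (x :: s) u) <= k)%N by rewrite size_rcons sz ltnn.
    apply: longest; first by rewrite rcons_uniq us.
    rewrite /= rcons_path; apply/andP; split => //.
    by move: eu; rewrite iE /w /l nth_last.
  have [||uE|uE] := @interior i.-1 u _ _; rewrite ?prednK //.
  - by rewrite ltn_neqAle iE.
  - by case/negP: us; rewrite uE; apply: mem_nth; rewrite /= -/l; lia.
  - by case/negP: us; rewrite uE; apply: mem_nth; rewrite /= -/l; lia.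
have all_in u : u \in x :: s.
  have := econn [set v in x :: s]%SET x; rewrite inE mem_head => /(_ isT) H.
  have : u \in [set v in x :: s]%SET; last by rewrite inE.
  apply: H => v v'; rewrite [v \in _]inE [v' \in _]inE => /wmem[i il <-].
  exact: closed.
have edges i j : (i < j)%N -> (j <= l)%N -> e (w i) (w j) ->
    j = i.+1 \/ (i = 0%N /\ j = l).
  move=> ij jl eij; have [i0|i0] := posnP i.
    have [jE|jE] := eqVneq j l; first by right.
    have [||/winj|/winj] := @interior j.-1 (w i) _ _; rewrite ?prednK; try lia.
    by rewrite esym.
  have [||/winj|/winj] := @interior i.-1 (w j) _ _; rewrite ?prednK //; lia.
have cover v v' : e v v' -> (exists2 i, (i < l)%N &
    (v = w i /\ v' = w i.+1) \/ (v' = w i /\ v = w i.+1)) \/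
    (v = w 0%N /\ v' = w l) \/ (v' = w 0%N /\ v = w l).
  move=> ev; have [i il iE] := wmem v (all_in v).
  have [j jl jE] := wmem v' (all_in v'); rewrite -iE -jE in ev *.
  have [ij|ji|ijE] := ltngtP i j; last by rewrite ijE eirr in ev.
    have [jE'|[i0 j0]] := edges i j ij jl ev.
      by left; exists i; [lia|left; rewrite jE'].
    by right; left; rewrite i0 j0.
  rewrite esym in ev; have [jE'|[i0 j0]] := edges j i ji il ev.
    by left; exists j; [lia|right; rewrite jE'].
  by right; right; rewrite i0 j0.
have [/andP[l2 el]|nol] := boolP ((1 < l)%N && e (w 0%N) (w l)); last first.
  exists l, w; split => //; last by left.
    by move=> v; apply/wmem/all_in.
  move=> v v' ev; have [//|far] := cover v v' ev.
  have l1 : (l <= 1)%N.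
    rewrite leqNgt; apply: contra nol => ->.
    by case: far ev => -[-> ->] //; rewrite esym.
  have l0 : (0 < l)%N.
    rewrite lt0n; apply: contraTneq ev => l0.
    by case: far => -[-> ->]; rewrite l0 eirr.
  have lE : l = 1%N by lia.
  by exists 0%N => //; rewrite lE in far.
have wl : w l.+1 = w 0%N by rewrite /w nth_default.
exists l.+1, w; split.
- move=> i; rewrite ltnS leq_eqVlt => /orP[/eqP ->|]; last exact: wedge.
  by rewrite wl esym.
- by move=> v; have [i il <-] := wmem v (all_in v); exists i => //; exact: leqW.
- move=> v v' /cover[[i il iE]|]; first by exists i => //; exact: leqW.
  by exists l => //; rewrite wl; tauto.
- by right; split => // i j; rewrite !ltnS; exact: winj.
Qed.

(** * Arcs and closed curves *)

Section Quotient.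
Context {R : realType} {Z W : topologicalType} (D : set R)
  (F : R -> Z) (E : R -> W).
Hypothesis Zhaus : hausdorff_space Z.
Hypothesis cD : compact D.
Hypothesis cF : continuous F.
Hypothesis cE : continuous E.

(** The preimage of a closed set under the induced map is the image under F of a
    compact set. *)
Lemma factor_through : (forall s t, D s -> D t -> F s = F t -> E s = E t) ->
  exists h : set_type (F @` D) -> set_type (E @` D),
    continuous h /\
    forall x t, D t -> set_val x = F t -> set_val (h x) = E t.
Proof.
move=> FE.
have /choice[h hE] (x : set_type (F @` D)) : exists y : set_type (E @` D),
    forall t, D t -> set_val x = F t -> set_val y = E t.
  have [s Ds xs] : (F @` D) (set_val x) by exact: set_valP.
  exists (SigSub (mem_set (imageP E Ds))) => t Dt xt.
  by rewrite set_valE /=; apply: FE => //; rewrite xs.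
exists h; split=> //; apply: set_type_continuous.
apply/continuous_closedP => A cA.
rewrite (_ : _ @^-1` A = set_val @^-1` (F @` (D `&` E @^-1` A))).
  apply: (iffLR (continuous_closedP _)); first exact: initial_continuous.
  apply: compact_closed => //; apply: continuous_compact.
    exact: continuous_subspaceT.
  by apply: compact_closedI => //; apply: (iffLR (continuous_closedP _)).
apply/seteqP; split=> x /=.
  have [s Ds xs] : (F @` D) (set_val x) by exact: set_valP.
  by rewrite (hE x s Ds (esym xs)) => AEs; exists s.
by move=> [s [Ds AEs] xs]; rewrite (hE x s Ds (esym xs)).
Qed.

End Quotient.

(** A continuous map from a compact set to a Hausdorff space is a quotient map onto
    its image, so that two such maps that identify the same points have
    homeomorphic images. *)
Lemma homeomorphic_images (R : realType) (Z W : topologicalType) (D : set R)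
    (F : R -> Z) (E : R -> W) :
    hausdorff_space Z -> hausdorff_space W -> compact D ->
    continuous F -> continuous E ->
    (forall s t, D s -> D t -> F s = F t <-> E s = E t) ->
  homeomorphic (set_type (F @` D)) (set_type (E @` D)).
Proof.
move=> Zhaus Whaus cD cF cE FE.
have [h [ch hE]] := factor_through Zhaus cD cF cE (fun s t Ds Dt => (FE s t Ds Dt).1).
have [k [ck kE]] := factor_through Whaus cD cE cF (fun s t Ds Dt => (FE s t Ds Dt).2).
exists h, k; split => // x; apply/val_inj; rewrite /= -!set_valE.
  have [s Ds xs] : (F @` D) (set_val x) by exact: set_valP.
  by rewrite (kE _ s) // (hE _ s).
have [s Ds xs] : (E @` D) (set_val x) by exact: set_valP.
by rewrite (hE _ s) // (kE _ s).
Qed.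

Lemma homeomorphic_trans (X Y Z : topologicalType) :
  homeomorphic X Y -> homeomorphic Y Z -> homeomorphic X Z.
Proof.
move=> [f [f' [cf cf' fK f'K]]] [g [g' [cg cg' gK g'K]]].
exists (g \o f), (f' \o g'); split.
- exact: comp_continuous cg cf.
- exact: comp_continuous cf' cg'.
- by move=> x /=; rewrite gK fK.
- by move=> x /=; rewrite f'K g'K.
Qed.

Lemma interval_image (R : realType) (m : nat) : (0 < m)%N ->
  (fun t : R => 0 + m%:R^-1 * t) @` `[0, m%:R]%classic = unit_interval R.
Proof.
move=> m0; have m0R : (0 : R) < m%:R by rewrite ltr0n.
apply/seteqP; split=> t /=.
  move=> [s]; rewrite /= !in_itv /= => s0m <-.
  rewrite /unit_interval /= in_itv /= add0r mulrC.
  by rewrite ler_pdivrMr // mul1r divr_ge0 /=; case/andP: s0m.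
rewrite /unit_interval /= in_itv /= => t01; exists (m%:R * t).
  rewrite /= in_itv /=; apply/andP; split; first by apply: mulr_ge0; lra.
  by rewrite -[leRHS]mulr1 ler_pM2l //; lra.
by rewrite add0r mulrA mulVf ?mul1r // lt0r_neq0.
Qed.

Definition circle_point {R : realType} (m : nat) (t : R) : R * R :=
  (cos (pi *+ 2 / m%:R * t), sin (pi *+ 2 / m%:R * t)).

Lemma circle_point_continuous (R : realType) (m : nat) :
  continuous (@circle_point R m).
Proof.
have c : continuous (fun t : R => pi *+ 2 / m%:R * t).
  by move=> t; apply: cvgM => //; exact: cvg_cst.
have c1 := comp_continuous (@continuous_cos R) c.
have c2 := comp_continuous (@continuous_sin R) c.
by move=> t; exact: (cvg_pair (c1 t) (c2 t)).
Qed.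

(** Since cos u = 1 - 2 sin^2 (u / 2), the angle u / 2 is a zero of the sine, which
    is positive strictly between 0 and pi. *)
Lemma cos1_small (R : realType) (u : R) : 0 <= u <= pi *+ 2 -> cos u = 1 ->
  u = 0 \/ u = pi *+ 2.
Proof.
move=> u2 cu.
have : sin (u / 2) = 0.
  have uE : u = (u / 2) *+ 2 by rewrite -mulr_natr divfK.
  move: cu; rewrite {1}uE cos_mulr2n => cu.
  have := cos2Dsin2 (u / 2) => cs; apply/eqP; rewrite -sqrf_eq0; apply/eqP; lra.
have [u0|u0] := ltrP 0 (u / 2); last by left; lra.
have [upi|upi] := ltrP (u / 2) pi; last by right; lra.
by have := sin_gt0_pi (introT andP (conj u0 upi)); move=> + e; rewrite e ltxx.
Qed.

Lemma circle_point_eq (R : realType) (m : nat) (s t : R) : (0 < m)%N ->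
  0 <= s <= m%:R -> 0 <= t <= m%:R -> s < t ->
  circle_point m s = circle_point m t <-> s = 0 /\ t = m%:R.
Proof.
move=> m0 sm tm st; have m0R : (0 : R) < m%:R by rewrite ltr0n.
have p0 := pi_gt0 R.
pose c : R := pi *+ 2 / m%:R.
have c0 : 0 < c by rewrite divr_gt0 // mulrn_wgt0.
have cm : c * m%:R = pi *+ 2 by rewrite divfK // lt0r_neq0.
split=> [[ecos esin]|[-> ->]]; last first.
  by rewrite /circle_point -/c cm mulr0 cos0 sin0 cos2pi sin2pi.
(* Equal points at angles c s and c t mean that the difference has cosine 1. *)
have : cos (c * t - c * s) = 1.
  by rewrite cosB /c ecos esin -!expr2 cos2Dsin2.
move/cos1_small; rewrite -mulrBr -cm => /(_ _)[|e|e].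
- by apply/andP; split; [apply: mulr_ge0; lra|rewrite ler_pM2l //; lra].
- have : c * (t - s) > 0 by apply: mulr_gt0; lra.
  by rewrite e ltxx.
- by have := mulfI (lt0r_neq0 c0) e; lra.
Qed.

Lemma circle_image (R : realType) (m : nat) : (0 < m)%N ->
  circle_point m @` `[0, m%:R]%classic = unit_circle R.
Proof.
move=> m0; have m0R : (0 : R) < m%:R by rewrite ltr0n.
have p0 := pi_gt0 R.
have angle (u : R) : 0 <= u <= pi *+ 2 ->
    exists2 t, `[0, m%:R]%classic t & circle_point m t = (cos u, sin u).
  move=> u2; have c0 : 0 < pi *+ 2 :> R by rewrite mulrn_wgt0.
  have /andP[q0 q1] : 0 <= u / (pi *+ 2) <= 1.
    by rewrite ler_pdivrMr // mul1r divr_ge0 /=; lra.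
  exists (m%:R * (u / (pi *+ 2))).
    by rewrite /= in_itv /= mulr_ge0 //= ler_piMr.
  rewrite /circle_point (_ : _ * _ = u) //.
  by rewrite mulrA divfK ?lt0r_neq0 // mulrC divfK ?lt0r_neq0.
apply/seteqP; split=> [p [t _ <-]|[a b]]; rewrite /unit_circle /=.
  exact: cos2Dsin2.
move=> ab; have a1 : -1 <= a <= 1.
  rewrite -ler_norml -(ler_pXn2r (n := 2)) ?nnegrE // real_normK ?num_real //.
  by rewrite expr1n; have := sqr_ge0 b; lra.
have ca : cos (acos a) = a by apply: acosK; rewrite in_itv.
have sa : sin (acos a) = `|b|.
  by rewrite sin_acos // -sqrtr_sqr; congr Num.sqrt; lra.
have u0 := acos_ge0 a1; have u1 := acos_lepi a1.
have [b0|b0] := lerP 0 b.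
  have [|t tm te] := angle (acos a); first by lra.
  by exists t => //; rewrite te ca sa ger0_norm.
have [|t tm te] := angle (pi *+ 2 - acos a); first by lra.
exists t => //; rewrite te cosB sinB cos2pi sin2pi !mul0r !mul1r addr0 sub0r ca sa.
by rewrite ltr0_norm // opprK.
Qed.

(** * Polygons *)

Section Polygon.
Context {R : realType} {N : nat}.

Definition hat (t : R) : R := Num.max 0 (1 - `|t|).

(** The polygonal line that visits the vertices w 0, ..., w m at integral
    times; hat functions make its continuity and its coordinates visible. *)
Definition polygon (m : nat) (w : nat -> 'I_N) (t : R) : 'rV[R]_N :=
  \sum_(i < m.+1) hat (t - i%:R) *: vert (w i).

Lemma hat_out t : 1 <= `|t| -> hat t = 0.
Proof. by move=> t1; rewrite /hat max_l // subr_le0. Qed.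

Lemma hat_pos t : 0 <= t <= 1 -> hat t = 1 - t.
Proof. by move=> /andP[t0 t1]; rewrite /hat ger0_norm // max_r // subr_ge0. Qed.

Lemma hat_neg t : -1 <= t <= 0 -> hat t = 1 + t.
Proof.
by move=> /andP[t1 t0]; rewrite /hat ler0_norm // opprK max_r //; lra.
Qed.

Lemma hat_lt_right s t : 0 <= s < 1 -> s < t -> hat t < hat s.
Proof.
move=> s01 st; rewrite (@hat_pos s); last by lra.
by rewrite /hat gt_max ger0_norm; lra.
Qed.

Lemma hat_lt_left s t : -1 < t <= 0 -> s < t -> hat s < hat t.
Proof.
move=> t01 st; rewrite (@hat_neg t); last by lra.
by rewrite /hat gt_max ler0_norm; lra.
Qed.

Lemma polygon_continuous m w : continuous (polygon m w).
Proof.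
apply: continuous_big => [|i _]; first exact: add_continuous.
have ch : continuous hat.
  move=> t; apply: (@continuous_max _ _ (cst 0) (fun u => 1 - `|u|)).
    exact: cst_continuous.
  by apply: cvgB; [exact: cvg_cst|exact: cvg_norm].
have cs : continuous (fun t : R => t - i%:R).
  by move=> t; apply: cvgB => //; exact: cvg_cst.
have chs := comp_continuous ch cs.
by move=> t; apply: cvgZ; [exact: chs|exact: cvg_cst].
Qed.

Lemma polygon_coord m w t v :
  polygon m w t 0 v = \sum_(i < m.+1 | w i == v) hat (t - i%:R).
Proof.
rewrite summxE [RHS]big_mkcond; apply: eq_bigr => i _.
by rewrite mxE vertE eq_sym; case: eqP => _; rewrite ?mulr1 ?mulr0.
Qed.

Lemma polygon_coord1 m w t i : (i <= m)%N ->
    (forall k, (k <= m)%N -> w k = w i -> k = i) ->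
  polygon m w t 0 (w i) = hat (t - i%:R).
Proof.
move=> im wi; rewrite polygon_coord (bigD1 (Ordinal (im : (i < m.+1)%N))) //=.
rewrite big1 ?addr0 // => k /andP[/eqP /wi wk /eqP ki].
by case: ki; apply: val_inj; apply: wk; rewrite -ltnS.
Qed.

Lemma polygon_edge m w i s : (i < m)%N -> 0 <= s <= 1 ->
  polygon m w (i%:R + s) = vert (w i) + s *: (vert (w i.+1) - vert (w i)).
Proof.
move=> im s01; rewrite /polygon.
have i1 : (i < m.+1)%N by rewrite ltnS ltnW.
rewrite (bigD1 (Ordinal i1)) //= (bigD1 (Ordinal (im : (i.+1 < m.+1)%N))) /=; last first.
  by apply/eqP => -[]; lia.
rewrite big1 ?addr0 => [|k /andP[ki ki1]]; last first.
  rewrite hat_out ?scale0r //.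
  have [kli|ilk|kE] := ltngtP k i; last by case/eqP: ki; apply: val_inj.
    have : (k.+1%:R : R) <= i%:R by rewrite ler_nat.
    rewrite -natr1 => ?; rewrite ger0_norm; lra.
  have : (i.+2%:R : R) <= k%:R.
    rewrite ler_nat ltn_neqAle ilk andbT.
    by apply/eqP => e; case/eqP: ki1; apply: val_inj.
  rewrite -!natr1 => ?; rewrite ler0_norm; lra.
have -> : hat (i%:R + s - i%:R) = 1 - s by rewrite hat_pos; lra.
have -> : hat (i%:R + s - i.+1%:R) = s by rewrite -natr1 hat_neg; lra.
by rewrite scalerBl scale1r scalerBr addrAC addrA.
Qed.

Lemma polygon_time m (t : R) : (0 < m)%N -> 0 <= t <= m%:R ->
  exists i s, [/\ (i < m)%N, 0 <= s <= 1 & t = i%:R + s].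
Proof.
elim: m t => // m IH t _ tm; have [mt|mt] := lerP m%:R t.
  exists m, (t - m%:R); split => //; last by lra.
  by move: tm; rewrite -natr1; lra.
have [m0|m0] := posnP m; first by move: mt tm; rewrite m0; lra.
have [|i [s [im s01 ->]]] := IH t m0; first by lra.
by exists i, s; split => //; exact: ltnW.
Qed.

(** For s < t, the images differ in the weight of the last vertex visited up to
    time s: this weight is positive at time s and strictly smaller ever after. *)
Lemma arc_inj m w (s t : R) :
    (forall i j, (i <= m)%N -> (j <= m)%N -> w i = w j -> i = j) ->
    0 <= s <= m%:R -> 0 <= t <= m%:R ->
  polygon m w s = polygon m w t <-> s = t.
Proof.
move=> winj sm tm; split => [|-> //].
wlog st : s t sm tm / s < t => [H|].
  by have [st|st|//] := ltgtP s t; [apply: H|move=> /esym e; apply/esym/H].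
move=> e; have /andP[is1 s1] := truncn_itv (andP sm).1.
set i := Num.truncn s in is1 s1.
have im : (i <= m)%N by rewrite -(ler_nat R); lra.
have ci u := @polygon_coord1 m w u i im (fun k km => @winj k i km im).
have : polygon m w t 0 (w i) < polygon m w s 0 (w i).
  by rewrite !ci; apply: hat_lt_right; move: s1; rewrite -natr1; lra.
by rewrite e ltxx.
Qed.

(** For a closed polygon the same argument applies unless s lies on the first
    edge and, symmetrically, t lies on the last one; as there are at least three
    edges, the weights of the first two vertices then give s = 0 and t = m. *)
Lemma closed_curve_inj m w (s t : R) : (2 < m)%N -> w m = w 0%N ->
    (forall i j, (i < m)%N -> (j < m)%N -> w i = w j -> i = j) ->
    0 <= s <= m%:R -> 0 <= t <= m%:R -> s < t ->
  polygon m w s = polygon m w t <-> s = 0 /\ t = m%:R.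
Proof.
move=> m2 wm winj sm tm st.
have m2R : (3 : R) <= m%:R by rewrite ler_nat.
have inner i u : (0 < i < m)%N -> polygon m w u 0 (w i) = hat (u - i%:R).
  move=> /andP[i0 im]; apply: polygon_coord1; first exact: ltnW.
  move=> k; rewrite leq_eqVlt => /orP[/eqP->|km]; last exact: winj.
  by rewrite wm => /(winj _ _ (ltnW (ltnW m2)) im) i0'; rewrite -i0' in i0.
have first u : polygon m w u 0 (w 0%N) = hat u + hat (u - m%:R).
  rewrite polygon_coord (bigD1 ord0) //= (bigD1 ord_max) /=; last first.
    by rewrite /= wm eqxx -val_eqE /= -lt0n (ltn_trans _ m2).
  rewrite big1 ?addr0 ?subr0 // => k /andP[/andP[/eqP wk k0] km].
  have kltm : (k < m)%N by rewrite ltn_neqAle -ltnS ltn_ord andbT.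
  by case/eqP: k0; apply: val_inj; apply: (winj k 0%N) => //; exact: ltnW (ltnW m2).
split=> [e|[-> ->]]; last first.
  apply/rowP => v; have [[i im wi]|no] := pselect (exists2 i, (i < m)%N & w i = v).
    have [i0|i0] := posnP i.
      rewrite -wi i0 !first subrr sub0r [RHS]addrC; congr (_ + _).
      by rewrite /hat normrN.
    have i1 : (1 : R) <= i%:R by rewrite ler1n.
    have i2 : (i.+1%:R : R) <= m%:R by rewrite ler_nat.
    rewrite -wi !inner ?i0 // !hat_out //.
      by rewrite -natr1 in i2; rewrite ger0_norm; lra.
    by rewrite ler0_norm; lra.
  have no' (i : 'I_m.+1) : (w i == v) = false.
    apply/eqP => wi; apply: no.
    have := ltn_ord i; rewrite ltnS leq_eqVlt => /orP[/eqP im|im].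
      by exists 0%N; [lia|rewrite -wm -im].
    by exists i.
  by rewrite !polygon_coord !big_pred0.
have s1 : s < 1.
  have /andP[is1 s1] := truncn_itv (andP sm).1.
  set i := Num.truncn s in is1 s1.
  have im : (i < m)%N by rewrite -(ltr_nat R); lra.
  have [i0|i0] := posnP i; first by rewrite i0 in s1.
  have : polygon m w t 0 (w i) < polygon m w s 0 (w i).
    by rewrite !inner ?i0 //; apply: hat_lt_right; move: s1; rewrite -natr1; lra.
  by rewrite e ltxx.
have tm1 : m%:R - 1 < t.
  have mt0 : 0 <= m%:R - t by lra.
  have /andP[is1 t1] := truncn_itv mt0.
  set l := Num.truncn (m%:R - t) in is1 t1.
  have lm : (l < m)%N by rewrite -(ltr_nat R); lra.
  have [l0|l0] := posnP l; first by rewrite l0 in t1; lra.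
  have mlm : (0 < m - l < m)%N.
    by rewrite subn_gt0 lm ltn_subrL l0 (leq_ltn_trans _ lm).
  have : polygon m w s 0 (w (m - l)%N) < polygon m w t 0 (w (m - l)%N).
    rewrite !(inner _ _ mlm) natrB; last exact: ltnW.
    by apply: hat_lt_left; move: t1; rewrite -natr1; lra.
  by rewrite e ltxx.
have := congr1 (fun x : 'rV_N => x 0 (w 0%N)) e.
have := congr1 (fun x : 'rV_N => x 0 (w 1%N)) e.
have m1 : (0 < 1 < m)%N by rewrite /= ltnW.
rewrite !first !(inner _ _ m1).
rewrite (@hat_pos s); last by lra.
rewrite (@hat_out t); last by rewrite ger0_norm; lra.
rewrite (@hat_out (s - m%:R)); last by rewrite ler0_norm; lra.
rewrite (@hat_neg (s - 1)); last by lra.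
rewrite (@hat_neg (t - m%:R)); last by lra.
rewrite (@hat_out (t - 1)); last by rewrite ger0_norm; lra.
by lra.
Qed.

End Polygon.

(** * Polyhedra without branching *)

Section Unbranched.
Context {R : realType} {N : nat} (K : {set {set 'I_N}}).
Hypothesis Kcplx : simplicial_complex K.
Hypothesis unbranched : ~ @branching R N K.
Hypothesis Bconn : connected [set: set_type (realization R K)].
Local Notation B := (realization R K).

Lemma face_edge a b (x : 'rV[R]_N) : a != b -> face [set a; b]%SET x ->
  0 <= x 0 b <= 1 /\ x = vert a + x 0 b *: (vert b - vert a).
Proof.
move=> ab [x0 x1 xs].
have sum : x 0 a + x 0 b = 1.
  rewrite -x1 (bigD1 a) //= (bigD1 b) /=; last by rewrite eq_sym.
  rewrite big1 ?addr0 // => v /andP[va vb].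
  by apply: xs; rewrite !inE negb_or va vb.
split; first by have := x0 a; have := x0 b; lra.
apply/rowP => v; rewrite !mxE !eqxx /=.
have [->|va] := eqVneq v a; first by rewrite (negbTE ab) /=; lra.
have [->|vb] := eqVneq v b; first by rewrite /=; lra.
by rewrite xs ?inE ?negb_or ?va ?vb //=; lra.
Qed.

Lemma polygon_image m w : (0 < m)%N ->
    (forall i, (i < m)%N -> adj K (w i) (w i.+1)) ->
    (forall v, exists2 i, (i <= m)%N & w i = v) ->
    (forall v v', adj K v v' -> exists2 i, (i < m)%N &
          (v = w i /\ v' = w i.+1) \/ (v' = w i /\ v = w i.+1)) ->
  polygon m w @` `[0, m%:R]%classic = B.
Proof.
move=> m0 wadj wall wcover.
apply/seteqP; split=> x.
  move=> [t]; rewrite /= in_itv /= => tm <-.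
  have [i [s [im s01 ->]]] := polygon_time m0 tm.
  rewrite polygon_edge //; have /andP[_ eK] := wadj i im.
  apply: (face_realization Kcplx eK).
  by apply: face_segment => //; apply: vert_face; rewrite !inE eqxx ?orbT.
move=> /(realization_face)[s sK [xs sE]].
have [v [v' [vv' xv]]] : exists v v', adj K v v' /\ face [set v; v']%SET x.
  have [s0|[v vs]] := set_0Vmem s; first by case: Kcplx; rewrite -s0 sK.
  have [sv|[v']] := set_0Vmem (s :\ v).
    have [v' vv'] : exists v', adj K v v'.
      have [i im <-] := wall v.
      have [iltm|iE] := ltnP i m; first by exists (w i.+1); exact: wadj.
      exists (w m.-1); rewrite adj_sym (_ : i = m.-1.+1); last by lia.
      by apply: wadj; lia.
    exists v, v'; split => //; have [x0 x1 xs0] := xs; split => // u.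
    rewrite !inE negb_or => /andP[uv _]; apply: xs0; apply/negP => us.
    have : u \in s :\ v by rewrite in_setD1 uv.
    by rewrite sv inE.
  move=> /setD1P[v'v v's]; exists v, v'; split.
    by apply: (simplex_adj Kcplx sK) => //; rewrite eq_sym.
  have [x0 x1 xs0] := xs; split => // u; rewrite !inE negb_or => /andP[uv uv'].
  apply: xs0; apply/negP => us; apply: unbranched.
  by apply: (triangle_branching sK v's vs us) => //; rewrite eq_sym.
have [i im vE] := wcover v v' vv'.
have {xv} xi : face [set w i; w i.+1]%SET x.
  by case: vE xv => -[-> ->] //; rewrite finset.setUC.
have /andP[wi _] := wadj i im; have [x01 xE] := face_edge wi xi.
exists (i%:R + x 0 (w i.+1)); last by rewrite polygon_edge.
have : (i.+1%:R : R) <= m%:R by rewrite ler_nat.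
have : (0 : R) <= i%:R by rewrite ler0n.
by rewrite /= in_itv /= -natr1; lra.
Qed.

(** Without branching, simplices have at most two vertices and vertices at most
    two neighbours, so that the polyhedron is parametrised by a polygonal line
    that is a point, simple, or simple and closed. *)
Lemma unbranched_classification (v0 : 'I_N) :
  [\/ forall x y, B x -> B y -> x = y,
      homeomorphic (set_type B) (set_type (unit_interval R)) |
      homeomorphic (set_type B) (set_type (unit_circle R))].
Proof.
have [||||m [w [wadj wall wcover winj]]] := @path_or_cycle _ (adj K) v0.
- exact: adj_sym.
- by move=> v; rewrite /adj eqxx.
- move=> v a b c va vb vc ab ac bc; apply: unbranched.
  exact: degree_branching va vb vc ab ac bc.
- by move=> S v vS Sadj u; apply: (connected_adj Kcplx Bconn vS Sadj).
have [m0|m0] := posnP m.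
  have only v : v = w 0%N.
    by have [i] := wall v; rewrite m0 leqn0 => /eqP -> ->.
  have one x : B x -> x = vert (w 0%N).
    move=> [_ x1 _]; apply/rowP => v; rewrite vertE (only v) eqxx -x1.
    by rewrite (bigD1 (w 0%N)) //= big1 ?addr0 // => u /eqP []; exact: only.
  by constructor 1 => x y /one -> /one ->.
have imB := polygon_image m0 wadj wall wcover.
have c0 : (m%:R^-1 : R) != 0 by rewrite invr_eq0 pnatr_eq0 -lt0n.
case: winj => [winj|[m2 wm winj]].
- constructor 2; rewrite -imB -(interval_image R m0).
  apply: homeomorphic_images.
  + exact: norm_hausdorff.
  + exact: Rhausdorff.
  + exact: segment_compact.
  + exact: polygon_continuous.
  + exact: affine_continuous.
  + move=> s t /=; rewrite !in_itv /= => sm tm.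
    rewrite (arc_inj winj sm tm); split => [->//|].
    by move=> /addrI/(mulfI c0).
- constructor 3; rewrite -imB -(circle_image R m0).
  apply: homeomorphic_images.
  + exact: norm_hausdorff.
  + exact: norm_hausdorff.
  + exact: segment_compact.
  + exact: polygon_continuous.
  + exact: circle_point_continuous.
  + move=> s t /=; rewrite !in_itv /= => sm tm.
    wlog st : s t sm tm / s < t => [H|].
      have [st|st|->//] := ltgtP s t; first exact: H.
      by split=> /esym e; apply/esym/(H t s).
    by rewrite closed_curve_inj // circle_point_eq.
Qed.

End Unbranched.

(** * Configuration spaces of polyhedra *)

(** Configurations of X are the same as configurations of its image under a
    homeomorphism with a subspace B of Z, and these are points of a power of Z. *)
Lemma config_path (R : realType) (X Z : topologicalType) (B : set Z) (n : nat)
    (f : X -> set_type B) (g : set_type B -> X)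
    (x y : set_type (configuration_space n X)) :
    continuous g -> cancel f g -> cancel g f ->
    joined R (confs n B) (fun i => set_val (f (set_val x i)))
                         (fun i => set_val (f (set_val y i))) ->
  exists gamma : R -> set_type (configuration_space n X),
    [/\ {within `[0, 1]%classic, continuous gamma}, gamma 0 = x & gamma 1 = y].
Proof.
move=> cg fK gK [G [cG G0 G1 GB]].
pose q t i : set_type B := SigSub (mem_set ((GB t).2 i)).
pose p t : {ptws 'I_n -> X} := fun i => g (q t i).
have qval t i : set_val (q t i) = G t i by rewrite set_valE.
have pconf t : configuration_space n X (p t).
  move=> i j ij /(can_inj gK)/(congr1 set_val); rewrite !qval => Gij.
  exact/ij/(GB t).1.
have pend t (z : set_type (configuration_space n X)) :
    G t = (fun i => set_val (f (set_val z i))) ->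
    SigSub (mem_set (pconf t)) = z :> set_type (configuration_space n X).
  move=> Gt; apply: val_inj; apply/funext => i /=; rewrite /p -[RHS]fK.
  by congr g; apply: val_inj; rewrite /= Gt.
exists (fun t => SigSub (mem_set (pconf t))); split; [|exact: pend|exact: pend].
apply/continuous_subspaceT/set_type_continuous/ptws_continuous => i.
apply: (comp_continuous cg); apply: set_type_continuous.
have qG : (fun t => set_val (q t i)) = (fun t => G t i).
  by apply/funext => t; rewrite qval.
rewrite qG; exact: comp_continuous (@ptws_coord_continuous n Z i) cG.
Qed.

Theorem lemma6p2 (R : realType) (X : topologicalType) (n : nat)
    (polyX : finite_polyhedron R X) (connX : connected [set: X])
    (notInterval : ~ homeomorphic X (set_type (unit_interval R)))
    (notCircle : ~ homeomorphic X (set_type (unit_circle R)))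
    (n_ge1 : (1 <= n)%N) :
  path_connected R (set_type (configuration_space n X)).
Proof.
have [N [K [Kcplx XB]]] := polyX.
have [f [g [cf cg fK gK]]] := XB.
have Bconn : connected [set: set_type (realization R K)].
  have <- : f @` [set: X] = setT.
    by apply/seteqP; split=> // b _; exists (g b).
  by apply: connected_continuous_connected => //; exact: continuous_subspaceT.
move=> x y; apply: (config_path cg fK gK).
have inB (z : set_type (configuration_space n X)) :
    confs n (realization R K) (fun i => set_val (f (set_val z i))).
  split=> [i j /val_inj/(can_inj fK) zij|i]; last exact: set_valP.
  by apply: contrapT => ij; apply: (set_valP z) ij zij.
have [br|unbr] := pselect (@branching R N K).
  have [gam [tri legsB]] := branching_tripod Kcplx br.
  have path u v := @polyhedron_joined R N K Kcplx u v Bconn.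
  exact: (tripod_joined_confs (@norm_hausdorff _ _) tri legsB path (inB x) (inB y)).
have /realization_face[s sK _] := (inB x).2 (Ordinal n_ge1).
have [s0|[v0 _]] := set_0Vmem s; first by case: Kcplx; rewrite -s0 sK.
case: (unbranched_classification Kcplx unbr Bconn v0) => [one|hI|hC].
- rewrite (_ : (fun i => set_val (f (set_val y i))) =
               (fun i => set_val (f (set_val x i)))).
    exact: joined_refl.
  by apply/funext => i; apply: one; exact: set_valP.
- by case: notInterval; exact: homeomorphic_trans XB hI.
- by case: notCircle; exact: homeomorphic_trans XB hC.
Qed.
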